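(* Let $d\ge 1$, $T>0$, and let $h\in C^\infty([0,T]\times\mathbf{T}^d)$ be a smooth solution to the mean-curvature equation $$\partial_th+\sqrt{1+|\nabla h|^2}\,\kappa=0\quad\text{with}\quad\kappa=-\operatorname{div}\left(\frac{\nabla h}{\sqrt{1+|\nabla h|^2}}\right).$$ Then, for all $t\in[0,T]$, $$\frac{d}{dt}\int_{\mathbf{T}^d}|\nabla h|^2\,dx\le0 .$$
   Context: $\mathbf{T}^d$ is a $d$-dimensional (flat) torus; $\nabla$ and $\operatorname{div}$ are taken with respect to $x\in\mathbf{T}^d$. *)

(* Defs.v *)
From HB Require Import structures.
From mathcomp Require Import all_boot all_order all_algebra.
From mathcomp Require Import all_classical all_reals all_analysis.

Set Implicit Arguments.
Unset Strict Implicit.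
Unset Printing Implicit Defensive.

Import Order.TTheory GRing.Theory Num.Theory.
Import numFieldNormedType.Exports.

Local Open Scope classical_set_scope.
Local Open Scope ring_scope.

(* The library has no Lebesgue measure on R^n for general n; it is built here
   on n.-tuple R by iterating the library's product measure and transporting
   it along the measurable bijection R * n.-tuple R -> n.+1.-tuple R. *)
Section lebesgue_tuple.
Variable R : realType.
Local Notation mR := (measurableTypeR R).

Definition cons_pair n (p : mR * n.-tuple mR) : n.+1.-tuple mR :=
  [tuple of p.1 :: p.2].

Definition uncons_pair n (u : n.+1.-tuple mR) : mR * n.-tuple mR :=
  (thead u, [tuple of behead u]).

Lemma measurable_cons_pair n : measurable_fun setT (@cons_pair n).
Proof. exact: measurable_cons. Qed.

Lemma measurable_uncons_pair n : measurable_fun setT (@uncons_pair n).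
Proof.
by apply: measurable_fun_pair; [exact: measurable_tnth|exact: measurable_behead].
Qed.

Lemma cons_pairK n : cancel (@cons_pair n) (@uncons_pair n).
Proof. by move=> [x u]; congr pair; apply: val_inj. Qed.

Section lebesgue_cons.
Variables (n : nat) (mu : {sigma_finite_measure set (n.-tuple mR) -> \bar R}).

Definition lebesgue_cons : set (n.+1.-tuple mR) -> \bar R :=
  pushforward (@lebesgue_measure R \x mu)%E (@cons_pair n).

Let lebesgue_cons0 : lebesgue_cons set0 = 0%E.
Proof. by apply: measure0; exact: measurable_cons_pair. Qed.

Let lebesgue_cons_ge0 A : (0 <= lebesgue_cons A)%E.
Proof. by apply: measure_ge0; exact: measurable_cons_pair. Qed.

Let lebesgue_cons_sigma_additive : semi_sigma_additive lebesgue_cons.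
Proof.
by apply: measure_semi_sigma_additive; exact: measurable_cons_pair.
Qed.

HB.instance Definition _ := isMeasure.Build _ _ _ lebesgue_cons
  lebesgue_cons0 lebesgue_cons_ge0 lebesgue_cons_sigma_additive.

Let lebesgue_cons_sigma_finite : sigma_finite setT lebesgue_cons.
Proof.
have /sigma_finiteP[F [FT ndF Foo]] := sigma_finiteT (@lebesgue_measure R).
have /sigma_finiteP[G [GT ndG Goo]] := sigma_finiteT mu.
exists (fun k => @uncons_pair n @^-1` (F k `*` G k)).
  rewrite -preimage_bigcup (_ : \bigcup_k _ = setT) ?preimage_setT//.
  apply/seteqP; split=> // -[x u] _.
  have [i _ Fix] : (\bigcup_k F k) x by rewrite -FT.
  have [j _ Gju] : (\bigcup_k G k) u by rewrite -GT.
  exists (maxn i j) => //; split => /=.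
  - by move: x Fix; exact/subsetPset/ndF/leq_maxl.
  - by move: u Gju; exact/subsetPset/ndG/leq_maxr.
move=> k; have [mF Fk] := Foo k; have [mG Gk] := Goo k; split.
  rewrite -[X in measurable X]setTI; apply: measurable_uncons_pair => //.
  exact: measurableX.
rewrite /lebesgue_cons /pushforward -comp_preimage.
rewrite (_ : _ \o _ = id) ?preimage_id; last first.
  by rewrite funeqE; exact: cons_pairK.
by rewrite product_measure1E// lte_mul_pinfty// ge0_fin_numE.
Qed.

HB.instance Definition _ := Measure_isSigmaFinite.Build _ _ _ lebesgue_cons
  lebesgue_cons_sigma_finite.

End lebesgue_cons.

Fixpoint lebesgue_tuple n : {sigma_finite_measure set (n.-tuple mR) -> \bar R} :=
  if n is m.+1 then lebesgue_cons (lebesgue_tuple m) else \d_ [tuple].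

End lebesgue_tuple.

Section vector_calculus.
Variables (R : realType) (d : nat).
Implicit Types (f : 'rV[R]_d -> R) (V : 'rV[R]_d -> 'rV[R]_d).

Definition partial (i : 'I_d) f (x : 'rV[R]_d) : R := 'D_(delta_mx 0 i) f x.

Definition grad f (x : 'rV[R]_d) : 'rV[R]_d := \row_i partial i f x.

Definition divergence V (x : 'rV[R]_d) : R :=
  \sum_i partial i (fun y => V y 0 i) x.

(* Euclidean: the library norm on 'rV[R]_d is the sup norm. *)
Definition sqnorm (v : 'rV[R]_d) : R := \sum_i v 0 i ^+ 2.

(* kappa, for the graph of f *)
Definition mean_curvature f (x : 'rV[R]_d) : R :=
  - divergence
      (fun y => (Num.sqrt (1 + sqnorm (grad f y)))^-1 *: grad f y) x.

End vector_calculus.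

(* Derivative relative to a set A: two-sided in the interior of A, one-sided at
   the endpoints when A is a segment. *)
Section derive_in.
Variables (R : realType) (A : set R) (f : R -> R) (t : R).

Definition derivable_in : Prop :=
  cvg ((s - t)^-1 * (f s - f t) @[s --> within A t^']).

Definition derive_in : R :=
  lim ((s - t)^-1 * (f s - f t) @[s --> within A t^']).

End derive_in.

Section smooth.
Variables (R : realType) (d : nat) (T : R).
Implicit Types u : R -> 'rV[R]_d -> R.

Definition dtime u (t : R) (x : 'rV[R]_d) : R :=
  derive_in `[0, T] (u^~ x) t.

(* u is C^k on [0, T] * R^d, up to the boundary: all partial derivatives of
   order at most k in (t, x) exist and are continuous on the closed slab. Values
   of u at times outside [0, T] are irrelevant. *)
Fixpoint Ck (k : nat) u : Prop :=
  {within [set p : R * 'rV[R]_d | p.1 \in `[0, T]],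
     continuous (fun p => u p.1 p.2)} /\
  if k is k'.+1 then
    [/\ forall t x, t \in `[0, T] -> derivable_in `[0, T] (u^~ x) t,
        forall t x i, t \in `[0, T] -> derivable (u t) x (delta_mx 0 i),
        Ck k' (dtime u) &
        forall i, Ck k' (fun t => partial i (u t))]
  else True.

Definition smooth u : Prop := forall k, Ck k u.

End smooth.

(* The flat torus R^d / L, where L is the lattice spanned by the rows of an
   invertible matrix B (B = 1%:M is the standard torus (R/Z)^d). Functions on it
   are L-periodic functions on R^d. *)
Section torus.
Variables (R : realType) (d : nat) (B : 'M[R]_d).

Definition lattice_periodic (f : 'rV[R]_d -> R) : Prop :=
  forall (k : 'rV[int]_d) x, f (x + map_mx intr k *m B) = f x.

Definition unit_cube : set (d.-tuple (measurableTypeR R)) :=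
  [set u | forall i, tnth u i \in `[0, 1]].

(* Integral over the fundamental cell {u B | u in [0, 1]^d}, written in the
   coordinates u; `|\det B| is the volume of the cell. *)
Definition torus_integral (f : 'rV[R]_d -> R) : R :=
  `|\det B| * \int[lebesgue_tuple R d]_(u in unit_cube)
                f ((\row_i (tnth u i : R)) *m B).

End torus.

(* Main.v *)
Require Import Defs.
From HB Require Import structures.
From mathcomp Require Import all_boot all_order all_algebra.
From mathcomp Require Import all_classical all_reals all_analysis.
From mathcomp Require Import measurable_realfun ring lra.
Set Implicit Arguments.
Unset Strict Implicit.
Unset Printing Implicit Defensive.
Import Order.TTheory GRing.Theory Num.Theory.
Import numFieldNormedType.Exports.
Local Open Scope classical_set_scope.
Local Open Scope ring_scope.

(** Write [f = h t], [g] for the time derivative of [h] at [t], [D] for the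
    Laplacian of [f], [Q] for [<grad f, D^2 f grad f>] and [P = 1 + |grad f|^2].
    The equation says [g = D - Q / P]. Differentiating under the integral and
    exchanging time and space derivatives, the energy has derivative the integral
    of [2 <grad f, grad g>]. Integrating by parts twice over the torus,
    [int 2 <grad f, grad g> = - int 2 D g] and [int D^2 = int |D^2 f|^2], so the
    derivative is minus the integral of [D^2 - 2 D Q / P + |D^2 f|^2], which is
    pointwise nonnegative since [|Q| <= |D^2 f| P]. Both integrations by parts
    are done at once, by exhibiting a single periodic field whose divergence
    dominates [2 <grad f, grad g>]. *)

(** * Derivatives relative to a set *)

Lemma cvg_sumr (R : realType) (T : Type) (F : set_system T) {FF : Filter F} n
    (f : 'I_n -> T -> R) (a : 'I_n -> R) :
  (forall i, f i @ F --> a i) -> (fun s => \sum_i f i s) @ F --> \sum_i a i.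
Proof.
move=> fa.
rewrite (_ : (fun s => _) = \sum_i f i); last by apply/funext => s; rewrite fct_sumE.
elim/big_ind2 : _ => [|u a' v b' hu hv|i _]; [exact: cvg_cst|exact: cvgD|exact: fa].
Qed.

Section derivative_within.
Variable R : realType.
Implicit Types (A : set R) (f g : R -> R).

(** As a relation, the derivative is independent of the default value of [lim], and the calculus
    rules need not assume that [t] is a limit point of [A]. Uniqueness of the limit relative to
    [[0, T]] enters only in [has_derive_in_derivable]. *)
Definition has_derive_in A f (t l : R) :=
  (s - t)^-1 * (f s - f t) @[s --> within A t^'] --> l.

Lemma has_derive_inP A f t l : has_derive_in A f t l <->
  forall e, 0 < e -> exists2 r, 0 < r & forall s, A s -> s != t ->
    `|s - t| < r -> `|(s - t)^-1 * (f s - f t) - l| < e.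
Proof.
rewrite /has_derive_in; split.
  move=> /cvgrPdist_lt h e e0; have := h e e0.
  rewrite !near_withinE => /nbhs_ballP[r /= r0 hr].
  exists r => // s As st sr; rewrite distrC; apply: hr => //.
  by rewrite /ball/= distrC.
move=> h; apply/cvgrPdist_lt => e e0; have [r r0 hr] := h e e0.
rewrite !near_withinE; apply/nbhs_ballP; exists r => //= s sr st As.
by rewrite distrC; apply: hr => //; rewrite distrC.
Qed.

Lemma has_derive_in_continuous A f t l : has_derive_in A f t l ->
  f @ within A (nbhs t) --> f t.
Proof.
move=> /has_derive_inP /(_ 1 ltr01)[r r0 hr].
apply/cvgrPdist_lt => e e0; rewrite !near_withinE.
have l0 : 0 < `|l| + 1 by rewrite ltr_wpDl.
(* Within [r] of [t] the quotient is less than 1 away from [l], hence bounded by [|l| + 1]; the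
   second bound then keeps [|f t - f s|] below [e]. *)
apply/nbhs_ballP; exists (Num.min r (e / (`|l| + 1))) => /=.
  by rewrite lt_min r0 divr_gt0.
move=> s; rewrite /ball/= lt_min => /andP[sr se] As.
have [->|st] := eqVneq s t; first by rewrite subrr normr0.
have st0 : s - t != 0 by rewrite subr_eq0.
have := hr s As st; rewrite distrC => /(_ sr) h.
have -> : f t - f s = - ((s - t) * ((s - t)^-1 * (f s - f t))) by rewrite mulVKf// opprB.
rewrite normrN normrM distrC -ltr_pdivlMl ?normr_gt0; last by rewrite subr_eq0 eq_sym.
set q := _^-1 * (f s - f t) in h *.
have qb : `|q| < `|l| + 1.
  by rewrite -(subrK l q) addrC (le_lt_trans (ler_normD _ _))// ltrD2l.
rewrite (lt_le_trans qb)// ler_pdivlMl ?normr_gt0; last by rewrite subr_eq0 eq_sym.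
by rewrite -ler_pdivlMr// ltW.
Qed.

Lemma has_derive_inB A f g t a b : has_derive_in A f t a ->
  has_derive_in A g t b -> has_derive_in A (fun s => f s - g s) t (a - b).
Proof.
move=> hf hg; rewrite /has_derive_in.
rewrite (_ : (fun s => _) = (fun s => (s - t)^-1 * (f s - f t)
  - (s - t)^-1 * (g s - g t))); last by apply/funext => s; ring.
exact: cvgB.
Qed.

Lemma has_derive_inM A f g t a b : has_derive_in A f t a ->
  has_derive_in A g t b ->
  has_derive_in A (fun s => f s * g s) t (a * g t + f t * b).
Proof.
move=> hf hg; rewrite /has_derive_in.
rewrite (_ : (fun s => _) = (fun s => (s - t)^-1 * (f s - f t) * g s
  + f t * ((s - t)^-1 * (g s - g t)))); last by apply/funext => s; ring.
apply: cvgD; last by apply: cvgM => //; exact: cvg_cst.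
apply: cvgM => //.
(* The factor [g s] is taken along the punctured filter, which is finer than the one in
   [has_derive_in_continuous]. *)
apply: cvg_trans (has_derive_in_continuous hg).
apply: cvg_app => P wP; rewrite !nbhs_simpl /dnbhs /within /= in wP *.
by apply: (filterS _ wP) => s + _.
Qed.

Lemma has_derive_in_sum A n (f : 'I_n -> R -> R) t (a : 'I_n -> R) :
  (forall i, has_derive_in A (f i) t (a i)) ->
  has_derive_in A (fun s => \sum_i f i s) t (\sum_i a i).
Proof.
move=> hf; rewrite /has_derive_in.
rewrite (_ : (fun s => _) = (fun s => \sum_i (s - t)^-1 * (f i s - f i t))); last first.
  by apply/funext => s; rewrite -sumrB mulr_sumr.
exact: cvg_sumr.
Qed.

(** At interior points of a subsegment of [A] the relative derivative is two-sided, so the ordinary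
    mean value theorem applies. The bound on [|c - a|] covers both orders of [a] and [b], and
    [a = b], in one statement. *)
Lemma has_derive_in_MVT (A : interval R) f (f' : R -> R) a b :
  a \in A -> b \in A ->
  (forall s, s \in A -> has_derive_in [set` A] f s (f' s)) ->
  exists c, [/\ c \in A, `|c - a| <= `|b - a| & f b - f a = f' c * (b - a)].
Proof.
have H x y : x < y -> x \in A -> y \in A ->
  (forall s, s \in A -> has_derive_in [set` A] f s (f' s)) ->
  exists2 c, c \in `]x, y[ & f y - f x = f' c * (y - x).
  move=> xy xA yA hf.
  have sA z : x <= z <= y -> z \in A by apply: (@interval_is_interval _ A _ _ xA yA z).
  apply: MVT => //.
    move=> z zxy; have /andP[xz zy] : x < z < y by move: zxy; rewrite in_itv.
    have zA : z \in A by apply: sA; rewrite !ltW.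
    suff : h^-1 *: (f (h *: 1 + z) - f z) @[h --> 0^'] --> f' z.
      by move=> hz; apply: DeriveDef; [apply/cvg_ex; exists (f' z)|exact: cvg_lim hz].
    apply/cvgrPdist_lt => e e0; have /has_derive_inP/(_ e e0)[r r0 hr] := hf z zA.
    rewrite near_withinE; apply/nbhs_ballP.
    (* The last two bounds keep the shifted point between [x] and [y], hence in [A]. *)
    exists (Num.min r (Num.min (z - x) (y - z))) => /=.
      by rewrite !lt_min r0 !subr_gt0 xz zy.
    move=> h; rewrite /ball/= sub0r normrN !lt_min => /and3P[h1 h2 h3] h0.
    have := hr (h *: 1 + z); rewrite addrK /GRing.scale/= mulr1 distrC; apply => //.
      apply: sA; move: h2 h3; rewrite !ltr_norml => /andP[? ?] /andP[? ?].
      by apply/andP; split; lra.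
    by rewrite -subr_eq0 addrK.
  apply/subspace_continuousP => z /=; rewrite in_itv/= => zxy.
  apply: cvg_trans (has_derive_in_continuous (hf z (sA z zxy))).
  apply: cvg_app; apply: within_subset => w /=.
  by rewrite in_itv/=; exact: sA.
move=> aA bA hf; have [ab|ba|ab] := ltgtP a b.
- have [c cab e] := H _ _ ab aA bA hf; exists c; split => //.
    move: cab; rewrite in_itv => /andP[/ltW ac /ltW cb].
    by apply: (@interval_is_interval _ A _ _ aA bA c); rewrite ac.
  move: cab; rewrite in_itv => /andP[/= ac cb]; rewrite !ger0_norm; lra.
- have [c cab e] := H _ _ ba bA aA hf; exists c; split => //; last lra.
    move: cab; rewrite in_itv => /andP[/ltW ac /ltW cb].
    by apply: (@interval_is_interval _ A _ _ bA aA c); rewrite ac.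
  move: cab; rewrite in_itv => /andP[/= ac cb]; rewrite !ler0_norm; lra.
- by exists a; split; rewrite ?ab// !subrr ?mulr0.
Qed.

End derivative_within.

(* Both mixed derivatives are limits of the same second difference quotient; only
   difference quotients inside [I * J] are used, so one-sided derivatives suffice. *)
Lemma schwarz (R : realType) (I J : interval R) (g g1 g2 g12 g21 : R -> R -> R) a b :
  a \in I -> b \in J ->
  (forall e, 0 < e -> exists a', [/\ a' \in I, a' != a & `|a' - a| < e]) ->
  (forall e, 0 < e -> exists b', [/\ b' \in J, b' != b & `|b' - b| < e]) ->
  (forall s r, s \in I -> r \in J -> has_derive_in [set` I] (g^~ r) s (g1 s r)) ->
  (forall s r, s \in I -> r \in J -> has_derive_in [set` J] (g s) r (g2 s r)) ->
  (forall s r, s \in I -> r \in J -> has_derive_in [set` J] (g1 s) r (g12 s r)) ->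
  (forall s r, s \in I -> r \in J -> has_derive_in [set` I] (g2^~ r) s (g21 s r)) ->
  (forall e, 0 < e -> exists2 k, 0 < k & forall s r, s \in I -> r \in J ->
    `|s - a| < k -> `|r - b| < k -> `|g12 s r - g12 a b| < e) ->
  (forall e, 0 < e -> exists2 k, 0 < k & forall s r, s \in I -> r \in J ->
    `|s - a| < k -> `|r - b| < k -> `|g21 s r - g21 a b| < e) ->
  g12 a b = g21 a b.
Proof.
move=> aI bJ hI hJ h1 h2 h12 h21 c12 c21.
apply/eqP; rewrite -subr_eq0 -normr_le0; apply/ler_addgt0Pr => e e0; rewrite add0r.
have e2 : 0 < e / 2 by rewrite divr_gt0.
have [k k0 hk] := c12 _ e2; have [l l0 hl] := c21 _ e2.
have m0 : 0 < Num.min k l by rewrite lt_min k0.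
have [a' [a'I a'a]] := hI _ m0; rewrite lt_min => /andP[ak al].
have [b' [b'J b'b]] := hJ _ m0; rewrite lt_min => /andP[bk bl].
(* The second difference over the rectangle with opposite corners [(a, b)] and [(a', b')] is
   evaluated twice by the mean value theorem: first variable then second, and in the opposite
   order. *)
have [c [cI ca Ec]] := @has_derive_in_MVT R I (fun s => g s b' - g s b)
  (fun s => g1 s b' - g1 s b) a a' aI a'I
  (fun s sI => has_derive_inB (h1 s b' sI b'J) (h1 s b sI bJ)).
have [p [pJ pb Ep]] := @has_derive_in_MVT R J (g1 c) (g12 c) b b' bJ b'J
  (fun r rJ => h12 c r cI rJ).
have [q [qJ qb Eq]] := @has_derive_in_MVT R J (fun r => g a' r - g a r)
  (fun r => g2 a' r - g2 a r) b b' bJ b'J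
  (fun r rJ => has_derive_inB (h2 a' r a'I rJ) (h2 a r aI rJ)).
have [u [uI ua Eu]] := @has_derive_in_MVT R I (g2^~ q) (g21^~ q) a a' aI a'I
  (fun s sI => h21 s q sI qJ).
have E : g12 c p = g21 u q.
  rewrite Ep in Ec; rewrite Eu in Eq.
  have : (g12 c p - g21 u q) * ((b' - b) * (a' - a)) = 0.
    by rewrite mulrBl !mulrA -Ec mulrAC -Eq; ring.
  move/eqP; rewrite !mulf_eq0 !subr_eq0 (negbTE a'a) (negbTE b'b) !orbF.
  by move/eqP.
have := hk c p cI pJ (le_lt_trans ca ak) (le_lt_trans pb bk).
have := hl u q uI qJ (le_lt_trans ua al) (le_lt_trans qb bl).
rewrite E !ltr_norml => /andP[? ?] /andP[? ?].
by rewrite ler_norml; apply/andP; split; lra.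
Qed.

(** * Directional derivatives in a normed space *)

Section directional_derivative.
Variables (R : realType) (V : normedModType R).
Implicit Types (f : V -> R) (x v w : V).

Lemma is_derive_normP f x v l : is_derive x v f l <->
  forall e, 0 < e -> exists2 r, 0 < r & forall h, h != 0 -> `|h| < r ->
    `|h^-1 * (f (h *: v + x) - f x) - l| < e.
Proof.
split=> [[fxv <-] e e0|H].
  have /cvgrPdist_lt/(_ e e0) := fxv.
  rewrite near_withinE => /nbhs_ballP[r /= r0 hr]; exists r => // h h0 hh.
  by rewrite distrC; apply: hr => //; rewrite /ball/= sub0r normrN.
have H' : h^-1 *: ((f \o shift x) (h *: v) - f x) @[h --> 0^'] --> l.
  apply/cvgrPdist_lt => e e0; have [r r0 hr] := H _ e0.
  rewrite near_withinE; apply/nbhs_ballP; exists r => //= h.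
  by rewrite /ball/= sub0r normrN distrC => hh h0; exact: hr.
by apply: DeriveDef; [apply/cvg_ex; exists l|exact: cvg_lim H'].
Qed.

Lemma has_derive_in_line A f x v t : derivable f (x + t *: v) v ->
  has_derive_in A (fun s => f (x + s *: v)) t ('D_v f (x + t *: v)).
Proof.
move=> /derivableP/is_derive_normP H; apply/has_derive_inP => e e0.
have [r r0 hr] := H e e0; exists r => // s _ st sr.
have := hr (s - t); rewrite subr_eq0 => /(_ st sr).
by rewrite scalerBl addrCA subrK.
Qed.

Lemma is_derive_scalev f x v l a : is_derive x v f l ->
  is_derive x (a *: v) f (a * l).
Proof.
have [->|a0 H] := eqVneq a 0; first by rewrite scale0r mul0r => _; exact: is_derive0.
apply/is_derive_normP => e e0.
have /is_derive_normP/(_ (e / `|a|))[] := H; first by rewrite divr_gt0 ?normr_gt0.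
move=> r r0 hr; exists (r / `|a|); first by rewrite divr_gt0 ?normr_gt0.
move=> h h0 hh; have := hr (h * a); rewrite mulf_neq0// normrM -ltr_pdivlMr ?normr_gt0//.
move=> /(_ isT hh); rewrite ltr_pdivlMr ?normr_gt0// -normrM -scalerA.
set F := f _ - f x.
by rewrite (_ : _ * a = h^-1 * F - a * l)//; field; apply/andP.
Qed.

(** The increment along [h *: (v + w)] is one along [h *: w] followed by one along [h *: v]. The
    mean value theorem turns the latter into [h] times ['D_v f] at a nearby point, so continuity of
    ['D_v f] at [x] concludes, without Frechet differentiability. *)
Lemma is_derive_addv f x v w l : (forall y, derivable f y v) ->
  {for x, continuous ('D_v f)} -> is_derive x w f l ->
  is_derive x (v + w) f ('D_v f x + l).
Proof.
move=> dv cv H; apply/is_derive_normP => e e0.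
have e2 : 0 < e / 2 by rewrite divr_gt0.
have /is_derive_normP/(_ _ e2)[r r0 hr] := H.
have /cvgrPdist_lt/(_ _ e2) := cv => /nbhs_ballP[k /= k0 hk].
have m0 : 0 < `|v| + `|w| + 1 by rewrite ltr_wpDl// addr_ge0.
(* The second bound keeps the intermediate point [h *: w + x + c *: v], where [|c| <= |h|], within
   [k] of [x]. *)
exists (Num.min r (k / (`|v| + `|w| + 1))).
  by rewrite lt_min r0 divr_gt0.
move=> h h0; rewrite lt_min => /andP[hhr]; rewrite ltr_pdivlMr// => hhk.
have dl s : s \in `]-oo, +oo[ -> has_derive_in [set` `]-oo, +oo[]
    (fun s => f ((h *: w + x) + s *: v)) s ('D_v f ((h *: w + x) + s *: v)).
  by move=> _; exact: has_derive_in_line.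
have [c [_]] := has_derive_in_MVT (isT : 0 \in `]-oo, +oo[) (isT : h \in `]-oo, +oo[) dl.
rewrite !subr0 scale0r addr0 => ch Ec.
have -> : h *: (v + w) + x = h *: w + x + h *: v by rewrite scalerDr -addrA addrC.
have -> : f (h *: w + x + h *: v) - f x =
    'D_v f (h *: w + x + c *: v) * h + (f (h *: w + x) - f x) by rewrite -Ec; ring.
have h1 := hr h h0 hhr.
have : `|'D_v f x - 'D_v f (h *: w + x + c *: v)| < e / 2.
  apply: hk; rewrite -ball_normE /ball_/= distrC addrAC addrK.
  rewrite (le_lt_trans (ler_normD _ _))// !normrZ (le_lt_trans _ hhk)//.
  have := ler_wpM2r (normr_ge0 v) ch; have := normr_ge0 h; lra.
set D := 'D_v f (_ + _) => h2; rewrite (_ : _ - ('D_v f x + l) =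
  (h^-1 * (f (h *: w + x) - f x) - l) - ('D_v f x - D)); last by field.
by rewrite (le_lt_trans (ler_normB _ _))// [ltRHS]splitr ltrD.
Qed.

End directional_derivative.

(** * Functions of class C^1 *)

Section continuously_differentiable.
Variables (R : realType) (d : nat).
Implicit Types (f g : 'rV[R]_d -> R).

Definition C1 f := [/\ continuous f,
  (forall i x, derivable f x (delta_mx 0 i)) & forall i, continuous (partial i f)].

(** The coordinates of [v] are added one at a time by [is_derive_addv], whose continuity hypothesis
    is that of the partial derivatives. *)
Lemma C1_is_derive f x v : C1 f -> is_derive x v f (\sum_i v 0 i * partial i f x).
Proof.
move=> [_ df cf]; rewrite {1}(row_sum_delta v).
elim: (index_enum _) => [|i r IHr]; first by rewrite !big_nil; exact: is_derive0.
have dv y : is_derive y (v 0 i *: delta_mx 0 i) f (v 0 i * partial i f y).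
  by apply: is_derive_scalev; exact: derivableP.
have Dv : 'D_(v 0 i *: delta_mx 0 i) f = (fun y => v 0 i * partial i f y).
  by apply/funext => y; exact: derive_val.
rewrite !big_cons -(@derive_val _ _ _ x _ f _ (dv x)); apply: is_derive_addv => //.
by rewrite Dv; exact: (cvgM (cvg_cst _) (cf i x)).
Qed.

Lemma C1D f g : C1 f -> C1 g -> C1 (fun x => f x + g x).
Proof.
move=> [cf df df'] [cg dg dg']; split=> [x|i x|i].
- exact: (cvgD (cf x) (cg x)).
- exact: derivableD.
- rewrite (_ : partial i _ = (fun x => partial i f x + partial i g x)).
    by move=> x; exact: (cvgD (df' i x) (dg' i x)).
  by apply/funext => x; exact: deriveD.
Qed.

Lemma C1M f g : C1 f -> C1 g -> C1 (fun x => f x * g x).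
Proof.
move=> [cf df df'] [cg dg dg']; split=> [x|i x|i].
- exact: (cvgM (cf x) (cg x)).
- exact: derivableM.
- rewrite (_ : partial i _ = (fun x => f x * partial i g x + g x * partial i f x)).
    by move=> x; exact: (cvgD (cvgM (cf x) (dg' i x)) (cvgM (cg x) (df' i x))).
  by apply/funext => x; exact: deriveM.
Qed.

Lemma C1_cst a : C1 (fun=> a).
Proof.
split=> [|i x|i]; [exact: cst_continuous|exact: derivable_cst|].
rewrite (_ : partial i _ = cst 0); first exact: cst_continuous.
by apply/funext => x; exact: derive_cst.
Qed.

Lemma C1_sum n (f : 'I_n -> 'rV[R]_d -> R) : (forall i, C1 (f i)) ->
  C1 (fun x => \sum_i f i x).
Proof.
move=> hf; rewrite (_ : (fun x => _) = \sum_i f i); last first.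
  by apply/funext => x; rewrite fct_sumE.
by elim/big_ind : _ => [|u v|i _]; [exact: C1_cst|exact: C1D|exact: hf].
Qed.

Lemma partialD f g i x : C1 f -> C1 g ->
  partial i (fun y => f y + g y) x = partial i f x + partial i g x.
Proof. by move=> [_ df _] [_ dg _]; exact: deriveD. Qed.

Lemma partialM f g i x : C1 f -> C1 g ->
  partial i (fun y => f y * g y) x = f x * partial i g x + g x * partial i f x.
Proof. by move=> [_ df _] [_ dg _]; exact: deriveM. Qed.

Lemma partial_cst (a : R) i (x : 'rV[R]_d) : partial i (fun=> a) x = 0.
Proof. exact: derive_cst. Qed.

Lemma partial_sum n (f : 'I_n -> 'rV[R]_d -> R) i x : (forall j, C1 (f j)) ->
  partial i (fun y => \sum_j f j y) x = \sum_j partial i (f j) x.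
Proof.
move=> Cf; rewrite (_ : (fun y => _) = \sum_j f j); last first.
  by apply/funext => y; rewrite fct_sumE.
by rewrite /partial derive_sum// => j; have [_ df _] := Cf j.
Qed.

End continuously_differentiable.

(** * Integration over the unit cube *)

Section cube_integral.
Variable R : realType.
Local Notation mR := (measurableTypeR R).
Local Notation leb := (@lebesgue_measure R).
Local Notation I01 := (`[0%R, 1%R]%classic : set mR).

Lemma cons_pair_unit_cube n : @cons_pair R n @^-1` @unit_cube R n.+1 =
  I01 `*` @unit_cube R n.
Proof.
apply/seteqP; split=> -[x u] /=.
  move=> h; split=> [|i] /=; first by have := h ord0.
  by have := h (lift ord0 i); rewrite tnthS.
move=> [x01 h] i; case: (unliftP ord0 i) => [j ->|->//]; rewrite tnthS.
exact: h.
Qed.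

Lemma measurable_unit_cube n : measurable (@unit_cube R n).
Proof.
elim: n => [|n IHn].
  rewrite (_ : @unit_cube _ _ = setT)//.
  by apply/seteqP; split=> // u _ [].
(* Measurability comes from a preimage under [uncons_pair]; the equality of sets holds because
   [cons_pair] after [uncons_pair] is the identity. *)
rewrite -[X in measurable X]setTI (_ : @unit_cube _ _ =
  @uncons_pair R n @^-1` (I01 `*` @unit_cube R n)).
  by apply: measurable_uncons_pair => //; apply: measurableX.
rewrite -cons_pair_unit_cube -comp_preimage (_ : _ \o _ = id)//.
apply/funext => u /=; rewrite /cons_pair/=; apply: val_inj.
by rewrite [u in RHS]tuple_eta.
Qed.

Lemma lebesgue_measure01 : leb I01 = 1%E.
Proof.
transitivity (@lebesgue_measure R [set` `[0%R, 1%R]]) => //.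
by rewrite lebesgue_measure_itv/= lte01 sube0.
Qed.

Lemma lebesgue_tuple_unit_cube n : lebesgue_tuple R n (@unit_cube R n) = 1%E.
Proof.
elim: n => [|n IHn] /=.
  by rewrite diracE mem_set// => -[].
rewrite /lebesgue_cons /pushforward cons_pair_unit_cube product_measure1E//.
  by rewrite IHn [X in (X * _)%E]lebesgue_measure01 mule1.
exact: measurable_unit_cube.
Qed.

Lemma bounded_integrable_unit_cube n (f : n.-tuple mR -> R) M :
  measurable_fun setT f -> (forall u, @unit_cube R n u -> `|f u| <= M) ->
  (lebesgue_tuple R n).-integrable (@unit_cube R n) (EFin \o f).
Proof.
move=> mf fM; apply: measurable_bounded_integrable.
- exact: measurable_unit_cube.
- by rewrite [X in (X < _)%E]lebesgue_tuple_unit_cube ltry.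
- exact: measurable_funTS.
- exists M; split; first exact: num_real.
  by move=> x Mx u /fM /le_trans; apply; exact: ltW.
Qed.

Definition set_tnth n (u : n.-tuple R) (k : 'I_n) (s : R) : n.-tuple R :=
  [tuple (if i == k then s else tnth u i) | i < n].

Lemma set_tnth_cons0 n (x s : R) (v : n.-tuple R) :
  set_tnth [tuple of x :: v] ord0 s = [tuple of s :: v].
Proof.
apply: eq_from_tnth => i; rewrite tnth_mktuple.
by case: (unliftP ord0 i) => [j ->|->]; rewrite ?eqxx// ?tnthS.
Qed.

Lemma set_tnth_consS n (x s : R) (v : n.-tuple R) k :
  set_tnth [tuple of x :: v] (lift ord0 k) s = [tuple of x :: set_tnth v k s].
Proof.
apply: eq_from_tnth => i; rewrite tnth_mktuple.
case: (unliftP ord0 i) => [j ->|->]; last by [].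
by rewrite !tnthS tnth_mktuple (inj_eq lift_inj).
Qed.

Local Open Scope ereal_scope.

(** The measure on tuples is the pushforward of a product measure along [cons_pair], so Fubini
    computes the integral in either order. A bounded function on a set of measure 1 is
    integrable. *)
Lemma integral_unit_cubeS n (f : n.+1.-tuple mR -> R) M :
  measurable_fun setT f -> (forall u, @unit_cube R n.+1 u -> (`|f u| <= M)%R) ->
  (\int[lebesgue_tuple R n.+1]_(u in @unit_cube R n.+1) (f u)%:E =
   \int[leb]_(x in `[0%R, 1%R]) \int[lebesgue_tuple R n]_(v in @unit_cube R n)
      (f [tuple of x :: v])%:E) /\
  (\int[lebesgue_tuple R n.+1]_(u in @unit_cube R n.+1) (f u)%:E =
   \int[lebesgue_tuple R n]_(v in @unit_cube R n) \int[leb]_(x in `[0%R, 1%R])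
      (f [tuple of x :: v])%:E).
Proof.
move=> mf fM.
have mD : measurable (I01 `*` @unit_cube R n).
  by apply: measurableX => //; exact: measurable_unit_cube.
have mfc : measurable_fun setT (f \o @cons_pair R n).
  exact: measurableT_comp mf (@measurable_cons_pair R n).
have ifc : (leb \x lebesgue_tuple R n).-integrable
    (I01 `*` @unit_cube R n) (EFin \o (f \o @cons_pair R n)).
  apply: measurable_bounded_integrable => //.
  - rewrite [X in X < _]product_measure1E//; last exact: measurable_unit_cube.
    rewrite [X in (_ * X)%E]lebesgue_tuple_unit_cube.
    by rewrite [X in (X * _)%E]lebesgue_measure01 mule1 ltry.
  - exact: measurable_funTS.
  - exists M; split; first exact: num_real.
    move=> x Mx u uD; apply: le_trans (ltW Mx); apply: fM.
    by rewrite -cons_pair_unit_cube in uD.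
(* Extended by zero outside the cube, the integrand lives on the whole product, where Fubini is
   applied. *)
have ifc' : (leb \x lebesgue_tuple R n).-integrable setT
    ((EFin \o (f \o @cons_pair R n)) \_ (I01 `*` @unit_cube R n)).
  exact: (integrable_mkcond _ mD).1 ifc.
have -> : \int[lebesgue_tuple R n.+1]_(u in @unit_cube R n.+1) (f u)%:E =
    \int[leb \x lebesgue_tuple R n]_p
     ((EFin \o (f \o @cons_pair R n)) \_ (I01 `*` @unit_cube R n)) p.
  rewrite -integral_mkcond -cons_pair_unit_cube.
  apply: (@integral_pushforward _ _ _ _ _ _ (@measurable_cons_pair R n)
    (leb \x lebesgue_tuple R n) (@unit_cube R n.+1) (EFin \o f)).
  - exact/measurable_EFinP.
  - by rewrite cons_pair_unit_cube.
  - exact: measurable_unit_cube.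
split.
  rewrite -integral12_prod_meas1// [RHS]integral_mkcond.
  apply: eq_integral => x _ /=; rewrite patchE; case: ifPn => x01.
    rewrite [RHS]integral_mkcond; apply: eq_integral => v _; rewrite !patchE in_setX.
    by rewrite x01.
  by apply: integral0_eq => v _; rewrite patchE in_setX (negbTE x01).
rewrite -integral21_prod_meas1// [RHS]integral_mkcond.
apply: eq_integral => v _ /=; rewrite patchE; case: ifPn => vc.
  rewrite [RHS]integral_mkcond; apply: eq_integral => x _; rewrite !patchE in_setX.
  by rewrite vc andbT.
by apply: integral0_eq => x _; rewrite patchE in_setX (negbTE vc) andbF.
Qed.

(* Fubini in the order that integrates the k-th coordinate first. *)
Lemma integral_unit_cube_eq0 n (k : 'I_n) (f : n.-tuple mR -> R) M :
  measurable_fun setT f -> (forall u, @unit_cube R n u -> (`|f u| <= M)%R) ->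
  (forall u, @unit_cube R n u ->
     \int[leb]_(s in `[0%R, 1%R]) (f (set_tnth u k s))%:E = 0) ->
  \int[lebesgue_tuple R n]_(u in @unit_cube R n) (f u)%:E = 0.
Proof.
elim: n k f => [[]//|n IHn] k f mf fM f0.
have [E1 E2] := integral_unit_cubeS mf fM.
have cubeS x v : `[0%R, 1%R]%classic x -> @unit_cube R n v ->
    @unit_cube R n.+1 [tuple of x :: v].
  move=> x01 vc; have : (I01 `*` @unit_cube R n) (x, v) by [].
  by rewrite -cons_pair_unit_cube.
(* A later coordinate is reached by fixing the first one and using the induction hypothesis on the
   rest; the first coordinate itself uses the other order of integration. *)
case: (unliftP ord0 k) f0 => [j ->|->] f0.
  rewrite E1; apply: integral0_eq => x x01.
  apply: (IHn j (fun v => f [tuple of x :: v])).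
  - apply: measurableT_comp => //; apply: measurable_cons => //.
  - by move=> v vc; apply: fM; exact: cubeS.
  - move=> v vc; rewrite -[RHS](f0 [tuple of x :: v]); last exact: cubeS.
    by apply: eq_integral => s _; rewrite set_tnth_consS.
rewrite E2; apply: integral0_eq => v vc.
(* [set_tnth] overwrites the head, so any value in [[0, 1]] would do here. *)
rewrite -[RHS](f0 [tuple of 0%R :: v]).
  by apply: eq_integral => s _; rewrite set_tnth_cons0.
by apply: cubeS => //=; rewrite in_itv/= lexx ler01.
Qed.

End cube_integral.

(** * Integration over the torus *)

Lemma cvg_rowP (R : realType) d (T : Type) (F : set_system T) {FF : Filter F}
    (f : T -> 'rV[R]_d) (l : 'rV[R]_d) :
  (forall i, (fun t => f t 0 i) @ F --> l 0 i) -> f @ F --> l.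
Proof.
move=> fl; apply/cvg_ballP => e e0.
have : \forall t \near F, forall i, ball (l 0 i) e (f t 0 i).
  by apply: filter_forall => i; have /cvg_ballP/(_ e e0) := fl i.
by apply: filterS => t h; split=> // i j; rewrite ord1.
Qed.

Lemma continuous_mulmxr (R : realType) d (B : 'M[R]_d) :
  continuous (fun v : 'rV[R]_d => v *m B).
Proof.
move=> v; apply: (@cvg_rowP _ _ _ (nbhs v)) => i; rewrite mxE.
rewrite (_ : (fun t => _) = (fun t : 'rV[R]_d => \sum_j t 0 j * B j i)); last first.
  by apply/funext => t; rewrite mxE.
apply: (cvg_sumr (f := fun j (t : 'rV[R]_d) => t 0 j * B j i)) => j.
exact: (cvgM (@coord_continuous _ _ _ 0 j v) (cvg_cst _)).
Qed.

Section torus_integral.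
Variables (R : realType) (d : nat).
Local Notation mR := (measurableTypeR R).
Implicit Types (f g : 'rV[R]_d -> R).

Definition row_tuple (u : d.-tuple mR) : 'rV[R]_d := \row_i (tnth u i : R).

(* [f] is the pointwise limit of its restrictions to finer and finer grids. *)
Lemma measurable_continuous_row_tuple f : continuous f ->
  measurable_fun setT (f \o row_tuple).
Proof.
move=> cf.
pose N m : R := m.+1%:R.
have N0 m : 0 < N m by rewrite ltr0n.
pose p m (k : {ffun 'I_d -> int}) : 'rV[R]_d := \row_i ((k i)%:~R / N m).
pose q m (u : d.-tuple mR) : {ffun 'I_d -> int} :=
  [ffun i => Num.floor (N m * (tnth u i : R))].
apply: (@measurable_fun_cvg _ _ _ _ (fun m u => f (p m (q m u)))).
  move=> m _ Y mY; rewrite setTI.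
  rewrite (_ : _ @^-1` _ = \bigcup_k (if f (p m k) \in Y then
      \bigcap_(i in [set: 'I_d])
        [set u : d.-tuple mR | Num.floor (N m * (tnth u i : R)) = k i]
      else set0)).
    apply: countable_bigcupT_measurable => // k; case: ifPn => // _.
    apply: fin_bigcap_measurable => // i _.
    rewrite (_ : mkset _ = (@tnth d mR)^~ i @^-1`
      ([set` `[(k i)%:~R / N m, (k i + 1)%:~R / N m[] : set mR)).
      rewrite -[X in measurable X]setTI.
      by apply: measurable_tnth => //; exact: measurable_itv.
    apply/seteqP; split=> u /=; rewrite in_itv/= ler_pdivrMr// ltr_pdivlMr//.
      by move=> <-; rewrite mulrC floor_itv.
    by rewrite ![tnth u i * _]mulrC -floor_eq => /eqP.
  apply/seteqP; split=> u /=.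
    move=> Yu; exists (q m u) => //; rewrite mem_set// => i _ /=.
    by rewrite ffunE.
  move=> [k _]; case: ifPn => [|//]; rewrite inE => Yk hk.
  rewrite (_ : q m u = k)//; apply/ffunP => i; rewrite ffunE; exact: hk.
move=> u _; apply: (@cvg_comp _ _ _ (fun m => p m (q m u)) f); last exact: cf.
apply: cvg_rowP => i; rewrite mxE.
rewrite (_ : (fun m => _) =
  (fun m => (Num.floor (N m * (tnth u i : R)))%:~R / N m)); last first.
  by apply/funext => m; rewrite mxE ffunE.
apply/cvgrPdist_lt => e e0; near=> m.
have /andP[h1 h2] := floor_itv (N m * (tnth u i : R)).
have Ne : (N m)^-1 < e by near: m; exact: near_infty_natSinv_lt (PosNum e0).
set x := tnth u i in h1 h2 *; set z := Num.floor _ in h1 h2 *.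
have -> : x - z%:~R / N m = (N m * x - z%:~R) / N m by field; rewrite gt_eqF.
rewrite normrM (gtr0_norm (x := _^-1)) ?invr_gt0// (le_lt_trans _ Ne)//.
rewrite ler_piMl ?invr_ge0 1?ltW//.
by move: h2; rewrite intrD => h2; rewrite ger0_norm; lra.
Unshelve. all: by end_near. Qed.

Variable B : 'M[R]_d.

Definition cell_point (u : d.-tuple mR) : 'rV[R]_d := row_tuple u *m B.

Definition cell : set 'rV[R]_d :=
  [set v *m B | v in [set v : 'rV[R]_d | forall i, `[0, 1]%classic (v 0 i)]].

Lemma compact_cell : compact cell.
Proof.
apply: continuous_compact.
  by apply: continuous_subspaceT => v; exact: continuous_mulmxr.
by apply: (@rV_compact R d (fun=> `[0, 1]%classic)) => i; exact: segment_compact.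
Qed.

Lemma cell_point_in_cell u : @unit_cube R d u -> cell (cell_point u).
Proof. by move=> cu; exists (row_tuple u) => // i; rewrite /= mxE; exact: cu. Qed.

Lemma continuous_cell_bounded f : continuous f ->
  exists M, forall u, @unit_cube R d u -> `|f (cell_point u)| <= M.
Proof.
move=> cf; have /compact_bounded[M [_ hM]] : compact (f @` cell).
  apply: continuous_compact; last exact: compact_cell.
  by apply: continuous_subspaceT => v; exact: cf.
exists (M + 1) => u cu; apply: (hM (M + 1)); first by rewrite ltrDl.
by exists (cell_point u) => //; exact: cell_point_in_cell.
Qed.

Lemma measurable_cell f : continuous f -> measurable_fun setT (f \o cell_point).
Proof.
move=> cf; apply: (@measurable_continuous_row_tuple (fun v => f (v *m B))) => v.
by apply: (@cvg_comp _ _ _ (fun v => v *m B) f); [exact: continuous_mulmxr|exact: cf].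
Qed.

Lemma integrable_cell f : continuous f ->
  (lebesgue_tuple R d).-integrable (@unit_cube R d) (EFin \o (f \o cell_point)).
Proof.
move=> cf; have [M hM] := continuous_cell_bounded cf.
by apply: bounded_integrable_unit_cube hM; exact: measurable_cell.
Qed.

Lemma torus_integralE f : torus_integral B f =
  `|\det B| * \int[lebesgue_tuple R d]_(u in @unit_cube R d) (f \o cell_point) u.
Proof. by []. Qed.

Lemma torus_integralD f g : continuous f -> continuous g ->
  torus_integral B (fun x => f x + g x) = torus_integral B f + torus_integral B g.
Proof.
move=> cf cg; rewrite !torus_integralE -mulrDr; congr (_ * _); apply: RintegralD;
  [exact: measurable_unit_cube|exact: integrable_cell|exact: integrable_cell].
Qed.

Lemma torus_integralZ a f : continuous f ->
  torus_integral B (fun x => a * f x) = a * torus_integral B f.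
Proof.
move=> cf; rewrite !torus_integralE mulrCA; congr (_ * _); apply: RintegralZl;
  [exact: measurable_unit_cube|exact: integrable_cell].
Qed.

Lemma torus_integral_cst a : torus_integral B (fun=> a) = `|\det B| * a.
Proof.
rewrite torus_integralE; congr (_ * _).
rewrite (_ : _ \o _ = cst a)// Rintegral_cst; last exact: measurable_unit_cube.
by rewrite [X in fine X]lebesgue_tuple_unit_cube mulr1.
Qed.

Lemma continuous_sumr n (f : 'I_n -> 'rV[R]_d -> R) :
  (forall i, continuous (f i)) -> continuous (fun x => \sum_i f i x).
Proof. by move=> cf x; apply: (@cvg_sumr _ _ (nbhs x)) => i; exact: cf. Qed.

Lemma torus_integral_sum n (f : 'I_n -> 'rV[R]_d -> R) :
  (forall i, continuous (f i)) ->
  torus_integral B (fun x => \sum_i f i x) = \sum_i torus_integral B (f i).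
Proof.
elim: n f => [|n IHn] f cf.
  rewrite big_ord0 (_ : (fun x => _) = fun=> 0) ?torus_integral_cst ?mulr0//.
  by apply/funext => x; rewrite big_ord0.
rewrite big_ord_recl -IHn// -torus_integralD//; last exact: continuous_sumr.
by congr (torus_integral B _); apply/funext => x; rewrite big_ord_recl.
Qed.

Lemma le_torus_integral f g : continuous f -> continuous g ->
  (forall u, @unit_cube R d u -> f (cell_point u) <= g (cell_point u)) ->
  torus_integral B f <= torus_integral B g.
Proof.
move=> cf cg fg; rewrite !torus_integralE ler_wpM2l//; apply: le_Rintegral => //;
  [exact: measurable_unit_cube|exact: integrable_cell|exact: integrable_cell].
Qed.

Lemma torus_integral_norm_le f e : continuous f ->
  (forall u, @unit_cube R d u -> `|f (cell_point u)| <= e) ->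
  `|torus_integral B f| <= `|\det B| * e.
Proof.
move=> cf fe; rewrite ler_norml -mulrN -!torus_integral_cst; apply/andP; split;
  apply: le_torus_integral => //; try exact: cst_continuous;
  by move=> u /fe; rewrite ler_norml => /andP[].
Qed.

End torus_integral.

Lemma is_derive_line (R : realType) (V : normedModType R) (f : V -> R) (x v : V)
    (t l : R) :
  is_derive (x + t *: v) v f l -> is_derive t 1 (fun s : R => f (x + s *: v)) l.
Proof.
move=> /is_derive_normP H; apply/is_derive_normP => e e0.
have [r r0 hr] := H e e0; exists r => // h h0 hh.
rewrite (_ : x + (h *: 1 + t) *: v = h *: v + (x + t *: v)); first exact: hr.
by rewrite scalerDl addrCA /GRing.scale/= mulr1.
Qed.

(** * Integrals of partial derivatives of periodic functions *)

Section torus_divergence.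
Variables (R : realType) (d : nat) (B : 'M[R]_d).
Local Notation mR := (measurableTypeR R).
Implicit Types (f : 'rV[R]_d -> R).

Lemma cell_point_set_tnth (u : d.-tuple mR) k s : cell_point B (set_tnth u k s) =
  cell_point B (set_tnth u k 0) + s *: row k B.
Proof.
rewrite /cell_point rowE scalemxAl -mulmxDl.
congr (_ *m _); apply/rowP => i; rewrite !mxE !tnth_mktuple eqxx/=.
by rewrite eq_sym; case: eqP => _; rewrite ?mulr1 ?add0r ?mulr0 ?addr0.
Qed.

(** The integrand is the derivative of [f] along [row k B], that is, along the [k]-th cell
    coordinate. Integrating that coordinate first leaves the difference of [f] at two points that
    differ by a lattice vector, which is zero. *)
Lemma torus_integral_derive_row f k : lattice_periodic B f -> C1 f ->
  torus_integral B (fun x => \sum_j B k j * partial j f x) = 0.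
Proof.
move=> pf Cf; have [cf _ cf'] := Cf.
set G := (fun x => _).
have cG : continuous G.
  apply: (continuous_sumr (f := fun j x => B k j * partial j f x)) => j x.
  exact: (cvgM (cvg_cst _) (cf' j x)).
have [M hM] := continuous_cell_bounded B cG.
rewrite torus_integralE /Rintegral.
rewrite (integral_unit_cube_eq0 (k := k) (measurable_cell B cG) hM) ?mulr0// => u cu.
pose x0 := cell_point B (set_tnth u k 0).
pose phi (s : R) := f (x0 + s *: row k B).
have dphi (s : R) : is_derive s 1 phi (G (x0 + s *: row k B)).
  apply: is_derive_line; have := C1_is_derive (x0 + s *: row k B) (row k B) Cf.
  by under eq_bigr do rewrite mxE.
have cphi (s : R) : {for s, continuous phi}.
  by apply/differentiable_continuous; rewrite -derivable1_diffP; have [] := dphi s.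
have cline : continuous (fun s : R => G (x0 + s *: row k B)).
  move=> s; apply: (@cvg_comp _ _ _ (fun s : R => x0 + s *: row k B) G); last exact: cG.
  exact: (cvgD (cvg_cst _) (cvgZ cvg_id (cvg_cst _))).
under eq_integral do rewrite /= cell_point_set_tnth.
rewrite (@continuous_FTC2 _ (fun s => G (x0 + s *: row k B)) phi 0 1)//.
- rewrite /phi scale0r scale1r addr0.
  (* The generator [row k B] is the lattice vector with integer coordinates [delta_mx 0 k]. *)
  have -> : x0 + row k B = x0 + map_mx intr (delta_mx 0 k : 'rV[int]_d) *m B.
    congr (_ + _); rewrite rowE; congr (_ *m _); apply/rowP => i; rewrite !mxE.
    by case: (_ && _).
  by rewrite pf subee.
- by apply: continuous_subspaceT => s; exact: cline.
- split=> [s _||]; first by have [] := dphi s.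
  + by apply: cvg_at_right_filter; exact: cphi.
  + by apply: cvg_at_left_filter; exact: cphi.
- by move=> s _; rewrite derive1E; exact: derive_val.
Qed.

(** Since [B] is invertible, the [i]-th basis vector is a combination of the rows of [B], with
    coefficients the [i]-th row of [invmx B]. This reduces the claim to derivatives along lattice
    generators. *)
Lemma torus_integral_partial f i : B \in unitmx -> lattice_periodic B f -> C1 f ->
  torus_integral B (partial i f) = 0.
Proof.
move=> uB pf Cf; have [_ _ cf'] := Cf.
have cG k : continuous (fun x => \sum_j B k j * partial j f x).
  apply: (continuous_sumr (f := fun j x => B k j * partial j f x)) => j x.
  exact: (cvgM (cvg_cst _) (cf' j x)).
have -> : partial i f =
    (fun x => \sum_k invmx B i k * \sum_j B k j * partial j f x).
  apply/funext => x.
  transitivity (\sum_j (invmx B *m B) i j * partial j f x).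
    rewrite mulVmx// (bigD1 i)//= mxE eqxx mul1r big1 ?addr0// => j ji.
    by rewrite mxE eq_sym (negbTE ji) mul0r.
  under [RHS]eq_bigr do rewrite mulr_sumr.
  rewrite exchange_big/=; apply: eq_bigr => j _; rewrite mxE mulr_suml.
  by apply: eq_bigr => k _; rewrite mulrA.
rewrite torus_integral_sum; last first.
  by move=> k x; exact: (cvgM (cvg_cst _) (cG k x)).
by rewrite big1// => k _; rewrite torus_integralZ// torus_integral_derive_row// mulr0.
Qed.

End torus_divergence.

(** * Joint continuity and differentiation under the integral *)

Section joint_continuity.
Variables (R : realType) (d : nat).
Implicit Types (I : interval R) (g : R -> 'rV[R]_d -> R).

Definition jointly_continuous I g := forall t x, t \in I -> forall e, 0 < e ->
  exists2 r, 0 < r & forall s y, s \in I -> `|s - t| < r -> ball x r y ->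
    `|g s y - g t x| < e.

Lemma within_jointly_continuous I g :
  {within [set p : R * 'rV[R]_d | p.1 \in I], continuous (fun p => g p.1 p.2)} ->
  jointly_continuous I g.
Proof.
move=> /subspace_continuousP cg t x tI e e0.
have /cvgrPdist_lt/(_ e e0) := cg (t, x) tI.
rewrite near_withinE => /nbhs_ballP[r /= r0 hr]; exists r => // s y sI st xy.
by rewrite distrC; apply: (hr (s, y)) => //; split => //=; rewrite /ball/= distrC.
Qed.

Lemma jointly_continuous_slice I g t : jointly_continuous I g -> t \in I ->
  continuous (g t).
Proof.
move=> cg tI x; apply/(@cvgrPdist_lt _ _ _ (nbhs x)) => e e0.
have [r r0 hr] := cg t x tI e e0.
apply/nbhs_ballP; exists r => //= y xy; rewrite distrC; apply: hr => //.
by rewrite subrr normr0.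
Qed.

(** The mean value theorem in time turns each difference quotient into [g'] at an intermediate time.
    Compactness of the cell makes [g'] close to [g' t] uniformly in space, so the quotients converge
    uniformly on the cell and their integrals converge. *)
Lemma torus_integral_has_derive_in (B : 'M[R]_d) I (g g' : R -> 'rV[R]_d -> R) t :
  t \in I -> (forall s, s \in I -> continuous (g s)) ->
  (forall s x, s \in I -> has_derive_in [set` I] (g^~ x) s (g' s x)) ->
  jointly_continuous I g' ->
  has_derive_in [set` I] (fun s => torus_integral B (g s)) t (torus_integral B (g' t)).
Proof.
move=> tI cg dg cg'; apply/has_derive_inP => e e0.
have cg't := jointly_continuous_slice cg' tI.
(* Adding 1 keeps [M] positive and makes [|\det B| * (e / M)] strictly less than [e]. *)
pose M := `|\det B| + 1.
have M0 : 0 < M by rewrite ltr_wpDl.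
have eM : 0 < e / M by rewrite divr_gt0.
(* The local radii given by [cg'] become a single one for the whole cell, through the covering form
   of compactness. *)
have [r [r0 hr]] : exists r, 0 < r /\
    cell B `<=` [set x | forall s, s \in I -> `|s - t| < r -> `|g' s x - g' t x| < e / M].
  have eM2 : 0 < e / M / 2 by rewrite divr_gt0.
  have /compact_near_coveringP cov := @compact_cell R d B.
  have n0 : \forall r \near (0 : R)^'+, 0 < r by exact: nbhs_right_gt.
  suff nr : \forall r \near (0 : R)^'+,
    cell B `<=` [set x | forall s, s \in I -> `|s - t| < r -> `|g' s x - g' t x| < e / M].
    by have [r] := filter_ex (filterI n0 nr); exists r.
  apply: cov => x _; have [r r0 hr] := cg' t x tI _ eM2.
  exists (ball x r, [set r' | r' < r]) => /=.
    by split; [exact: nbhsx_ballx|exact: nbhs_right_lt].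
  move=> [y r'] /= [xy r'r] s sI sr'.
  have h1 := hr s y sI (lt_trans sr' r'r) xy.
  have h2 : `|g' t y - g' t x| < e / M / 2.
    by apply: hr => //; rewrite subrr normr0.
  rewrite (_ : _ - _ = (g' s y - g' t x) - (g' t y - g' t x)); last by ring.
  by rewrite (le_lt_trans (ler_normB _ _))// [ltRHS]splitr ltrD.
exists r => // s sI st sr.
pose q x := (s - t)^-1 * (g s x + -1 * g t x).
have cN (f : 'rV[R]_d -> R) : continuous f -> continuous (fun x => -1 * f x).
  by move=> cf x; exact: (cvgM (cvg_cst _) (cf x)).
have cgN : continuous (fun x => g s x + -1 * g t x).
  by move=> x; exact: (cvgD (cg s sI x) (cN _ (cg t tI) x)).
have cq : continuous q by move=> x; exact: (cvgM (cvg_cst _) (cgN x)).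
have -> : (s - t)^-1 * (torus_integral B (g s) - torus_integral B (g t)) -
    torus_integral B (g' t) = torus_integral B (fun x => q x + -1 * g' t x).
  rewrite torus_integralD//; last exact: cN.
  rewrite [in RHS]torus_integralZ// [in RHS]torus_integralZ//.
  rewrite [in RHS]torus_integralD//; [|exact: cg|exact/cN/cg].
  by rewrite [in RHS]torus_integralZ ?mulN1r//; exact: cg.
apply: (@le_lt_trans _ _ (`|\det B| * (e / M))).
  apply: torus_integral_norm_le => [x|u cu].
    exact: (cvgD (cq x) (cN _ cg't x)).
  have [c [cI ct]] := has_derive_in_MVT tI sI (fun s' s'I => dg s' (cell_point B u) s'I).
  rewrite /q !mulN1r => ->; rewrite mulrC mulfK ?subr_eq0//.
  apply/ltW/hr => //; [exact: cell_point_in_cell|exact: le_lt_trans sr].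
by rewrite mulrCA gtr_pMr// ltr_pdivrMr// mul1r ltrDl.
Qed.

End joint_continuity.

(** * Symmetry of second derivatives *)

Section symmetry_of_derivatives.
Variables (R : realType) (d : nat).

(** Supplies the continuity hypotheses of [schwarz] when its second variable runs along a line in
    space. *)
Lemma continuous_line_eps (I : interval R) (g : R -> 'rV[R]_d -> R) t x v b :
  jointly_continuous I g -> t \in I -> forall e, 0 < e ->
  exists2 k, 0 < k & forall s r, s \in I -> r \in `]-oo, +oo[ ->
    `|s - t| < k -> `|r - b| < k -> `|g s (x + r *: v) - g t (x + b *: v)| < e.
Proof.
move=> cg tI e e0; have [r r0 hr] := cg t (x + b *: v) tI e e0.
have v0 : 0 < `|v| + 1 by rewrite ltr_wpDl.
exists (Num.min r (r / (`|v| + 1))); first by rewrite lt_min r0 divr_gt0.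
move=> s c sI _; rewrite !lt_min => /andP[sr _] /andP[_]; rewrite ltr_pdivlMr// => cr.
apply: hr => //; rewrite -ball_normE /ball_/= distrC opprD addrACA subrr add0r.
rewrite -scalerBl normrZ (le_lt_trans _ cr)// ler_wpM2l//.
by rewrite lerDl.
Qed.

Lemma itvNyy_limit_point (b e : R) : 0 < e ->
  exists b', [/\ b' \in `]-oo, +oo[, b' != b & `|b' - b| < e].
Proof.
move=> e0; exists (b + e / 2); split => //.
  by rewrite -subr_eq0 addrAC subrr add0r gt_eqF// divr_gt0.
by rewrite addrAC subrr add0r gtr0_norm; lra.
Qed.

(** [schwarz] applied at the origin to [f (x + r *: ej + s *: ei)], with [s] and [r] ranging over
    the whole real line. *)
Lemma partialC (f : 'rV[R]_d -> R) i j x : C1 f -> C1 (partial i f) ->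
  C1 (partial j f) -> partial j (partial i f) x = partial i (partial j f) x.
Proof.
move=> [_ df _] [_ dfi cfji] [_ dfj cfij].
have jc (F : 'rV[R]_d -> R) (v : 'rV[R]_d) : continuous F ->
    jointly_continuous `]-oo, +oo[ (fun s y => F (y + s *: v)).
  move=> cF; apply: within_jointly_continuous; apply: continuous_subspaceT => p.
  apply: (@cvg_comp _ _ _ (fun p : R * 'rV[R]_d => p.2 + p.1 *: v) F); last exact: cF.
  exact: (cvgD cvg_snd (cvgZ cvg_fst (cvg_cst _))).
have line (F : 'rV[R]_d -> R) (a : 'I_d) y (s : R) :
    (forall z, derivable F z (delta_mx 0 a)) ->
    has_derive_in [set` `]-oo, +oo[] (fun s => F (y + s *: delta_mx 0 a)) s
      (partial a F (y + s *: delta_mx 0 a)).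
  by move=> dF; exact: has_derive_in_line.
have line' (F : 'rV[R]_d -> R) (a : 'I_d) y w (s : R) :
    (forall z, derivable F z (delta_mx 0 a)) ->
    has_derive_in [set` `]-oo, +oo[] (fun s => F (y + s *: delta_mx 0 a + w)) s
      (partial a F (y + s *: delta_mx 0 a + w)).
  move=> dF; rewrite addrAC (_ : (fun s => _) =
    (fun s => F (y + w + s *: delta_mx 0 a))); first exact: line.
  by apply/funext => r; rewrite addrAC.
pose ei : 'rV[R]_d := delta_mx 0 i; pose ej : 'rV[R]_d := delta_mx 0 j.
have cont (F : 'rV[R]_d -> R) : continuous F -> forall e, 0 < e ->
    exists2 k, 0 < k & forall s r, s \in `]-oo, +oo[ -> r \in `]-oo, +oo[ ->
      `|s - 0| < k -> `|r - 0| < k -> `|F (x + r *: ej + s *: ei) - F x| < e.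
  move=> cF e e0; have [k k0 hk] := continuous_line_eps x ej 0
    (jc F ei cF) (isT : 0 \in `]-oo, +oo[) e0.
  exists k; first exact: k0.
  move=> s r sI rI s0 r0; move: (hk s r sI rI s0 r0) => /=.
  by rewrite !scale0r !addr0.
have := @schwarz R `]-oo, +oo[ `]-oo, +oo[ (fun s r => f (x + r *: ej + s *: ei))
  (fun s r => partial i f (x + r *: ej + s *: ei))
  (fun s r => partial j f (x + r *: ej + s *: ei))
  (fun s r => partial j (partial i f) (x + r *: ej + s *: ei))
  (fun s r => partial i (partial j f) (x + r *: ej + s *: ei)) 0 0.
rewrite !scale0r !addr0; apply => //.
- exact: itvNyy_limit_point.
- exact: itvNyy_limit_point.
- by move=> s r _ _; exact: line.
- by move=> s r _ _; exact: line'.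
- by move=> s r _ _; exact: line'.
- by move=> s r _ _; exact: line.
- exact: cont.
- exact: cont.
Qed.

End symmetry_of_derivatives.

(** * Smooth functions on the closed time slab *)

Section smooth_functions.
Variables (R : realType) (d : nat) (T : R).
Hypothesis T0 : 0 < T.
Implicit Types (u : R -> 'rV[R]_d -> R).

Lemma segment_limit_point t e : t \in `[0, T] -> 0 < e ->
  exists t', [/\ t' \in `[0, T], t' != t & `|t' - t| < e].
Proof.
rewrite in_itv/= => /andP[t0 tT] e0.
have [tT'|Tt] := ltP t T.
  have h0 : 0 < Num.min (T - t) (e / 2) by rewrite lt_min subr_gt0 tT' divr_gt0.
  exists (t + Num.min (T - t) (e / 2)); split.
  - rewrite in_itv/= addr_ge0 ?(ltW h0)//= -lerBrDl ge_min lexx//.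
  - by rewrite -subr_eq0 addrAC subrr add0r gt_eqF.
  - rewrite addrAC subrr add0r gtr0_norm// gt_min; apply/orP; right; lra.
have Et : t = T by apply/eqP; rewrite eq_le tT.
rewrite Et in t0 tT Tt *.
have h0 : 0 < Num.min T (e / 2) by rewrite lt_min T0 divr_gt0.
exists (T - Num.min T (e / 2)); split.
- by rewrite in_itv/= subr_ge0 ge_min lexx/= gerBl (ltW h0).
- by rewrite -subr_eq0 addrAC subrr add0r oppr_eq0 gt_eqF.
- rewrite addrAC subrr add0r normrN gtr0_norm// gt_min; apply/orP; right; lra.
Qed.

(** Makes limits along this filter unique, so that [derive_in] returns the actual derivative,
    endpoints included. *)
Lemma segment_proper_filter t : t \in `[0, T] -> ProperFilter (within `[0, T] t^').
Proof.
move=> tT; apply: Build_ProperFilter_ex => P /nbhs_ballP[e /= e0 he].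
have [s [sT st se]] := segment_limit_point tT e0.
by exists s; apply: he => //; rewrite /ball/= distrC.
Qed.

Lemma has_derive_in_derivable f t l : t \in `[0, T] ->
  has_derive_in `[0, T] f t l -> derivable_in `[0, T] f t /\ derive_in `[0, T] f t = l.
Proof.
move=> tT fl; split; first by apply/cvg_ex; exists l.
by have PF := segment_proper_filter tT; exact: cvg_lim fl.
Qed.

Lemma smooth_dtime u : smooth T u -> smooth T (dtime T u).
Proof. by move=> su k; have [_ []] := su k.+1. Qed.

Lemma smooth_partial u i : smooth T u -> smooth T (fun t => partial i (u t)).
Proof. by move=> su k; have [_ [_ _ _]] := su k.+1; exact. Qed.

Lemma smooth_within_continuous u : smooth T u ->
  {within [set p : R * 'rV[R]_d | p.1 \in `[0, T]], continuous (fun p => u p.1 p.2)}.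
Proof. by move=> su; have [] := su 0. Qed.

Lemma smooth_jointly_continuous u : smooth T u -> jointly_continuous `[0, T] u.
Proof. by move=> su; apply/within_jointly_continuous/smooth_within_continuous. Qed.

Lemma smooth_has_derive_in u t x : smooth T u -> t \in `[0, T] ->
  has_derive_in `[0, T] (u^~ x) t (dtime T u t x).
Proof. by move=> su tT; have [_ [h _ _ _]] := su 1; exact: h. Qed.

Lemma smooth_C1 u t : smooth T u -> t \in `[0, T] -> C1 (u t).
Proof.
move=> su tT; split.
- exact: jointly_continuous_slice (smooth_jointly_continuous su) tT.
- by move=> i x; have [_ [_ h _ _]] := su 1; exact: h.
- move=> i; apply: (jointly_continuous_slice (g := fun t => partial i (u t)) _ tT).
  exact/smooth_jointly_continuous/smooth_partial.
Qed.

(** [schwarz] with time in [[0, T]] and space along a line. At [t = 0] and [t = T] the time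
    derivatives are one-sided, which [schwarz] allows. *)
Lemma dtime_partial u i t x : smooth T u -> t \in `[0, T] ->
  dtime T (fun s => partial i (u s)) t x = partial i (dtime T u t) x.
Proof.
move=> su tT; pose ei : 'rV[R]_d := delta_mx 0 i.
have line v (r s : R) : smooth T v -> s \in `[0, T] ->
    has_derive_in [set` `]-oo, +oo[] (fun r => v s (x + r *: ei)) r
      (partial i (v s) (x + r *: ei)).
  by move=> sv sT; apply: has_derive_in_line; have [_ dv _] := smooth_C1 sv sT; exact: dv.
have cont v : smooth T v -> forall e, 0 < e ->
  exists2 k, 0 < k & forall s r, s \in `[0, T] -> r \in `]-oo, +oo[ ->
    `|s - t| < k -> `|r - 0| < k -> `|v s (x + r *: ei) - v t (x + 0 *: ei)| < e.
  by move=> sv; apply: continuous_line_eps => //; exact: smooth_jointly_continuous.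
have := @schwarz R `[0, T] `]-oo, +oo[ (fun s r => u s (x + r *: ei))
  (fun s r => dtime T u s (x + r *: ei)) (fun s r => partial i (u s) (x + r *: ei))
  (fun s r => partial i (dtime T u s) (x + r *: ei))
  (fun s r => dtime T (fun s => partial i (u s)) s (x + r *: ei)) t 0.
rewrite scale0r addr0 => H; symmetry; apply: H => //.
- by move=> e e0; exact: segment_limit_point.
- exact: itvNyy_limit_point.
- by move=> s r sT _; exact: (smooth_has_derive_in su sT).
- by move=> s r sT _; exact: (line u r s su sT).
- by move=> s r sT _; exact: (line (dtime T u) r s (smooth_dtime su) sT).
- move=> s r sT _.
  exact: (smooth_has_derive_in (smooth_partial i su) sT).
- have := cont (fun s => partial i (dtime T u s)); rewrite scale0r addr0; apply.
  exact/smooth_partial/smooth_dtime.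
- have := cont (dtime T (fun s => partial i (u s))); rewrite scale0r addr0; apply.
  exact/smooth_dtime/smooth_partial.
Qed.

End smooth_functions.

(** * Mean curvature of a graph and the energy *)

Section mean_curvature.
Variables (R : realType) (d : nat).
Implicit Types (f : 'rV[R]_d -> R).

Lemma is_derive_inv f x v l : f x != 0 -> is_derive x v f l ->
  is_derive x v (fun y => (f y)^-1) (- (f x) ^- 2 * l).
Proof.
move=> f0 [df <-]; apply: DeriveDef; first exact: derivableV.
exact: deriveV.
Qed.

(** Restricting [f] to the line through [x] in direction [v] reduces the claim to the one-variable
    chain rule. *)
Lemma is_derive_sqrt f x v l : 0 < f x -> is_derive x v f l ->
  is_derive x v (fun y => Num.sqrt (f y)) ((2 * Num.sqrt (f x))^-1 * l).
Proof.
move=> f0 fl; apply/is_derive_normP.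
have dphi : is_derive (0 : R) 1 (fun s : R => f (x + s *: v)) l.
  by apply: is_derive_line; rewrite scale0r addr0.
have ds : is_derive (f (x + 0 *: v)) 1 Num.sqrt (2 * Num.sqrt (f x))^-1.
  by rewrite scale0r addr0; exact: is_derive1_sqrt.
have /is_derive_normP H := is_derive1_comp ds dphi.
move=> e e0; have [r r0 hr] := H e e0; exists r => // h h0 hh.
have := hr h h0 hh; rewrite /= scale0r !addr0 /GRing.scale/= mulr1.
by rewrite [x + _]addrC.
Qed.

Lemma is_derive_inv_sqrt f x v l : 0 < f x -> is_derive x v f l ->
  is_derive x v (fun y => (Num.sqrt (f y))^-1) (- l / (2 * f x * Num.sqrt (f x))).
Proof.
move=> f0 fl; have s0 : Num.sqrt (f x) != 0 by rewrite gt_eqF// sqrtr_gt0.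
apply: is_derive_eq (is_derive_inv s0 (is_derive_sqrt f0 fl)) _.
set s := Num.sqrt (f x) in s0 *.
have -> : f x = s ^+ 2 by rewrite sqr_sqrtr// ltW.
by field.
Qed.

Definition laplacian f x := \sum_i partial i (partial i f) x.

Definition hessian_form f x :=
  \sum_i \sum_j partial i f x * partial j f x * partial i (partial j f) x.

Lemma sqnorm_grad f x : sqnorm (grad f x) = \sum_i partial i f x ^+ 2.
Proof. by apply: eq_bigr => i _; rewrite mxE. Qed.

(** With [P = 1 + |grad f|^2], the product rule gives the divergence of [P^(-1/2) grad f] as
    [P^(-1/2) laplacian f - P^(-3/2) hessian_form f]; the prefactor [P^(1/2)] clears the square
    roots. *)
Lemma mean_curvatureE f x : (forall i, C1 (partial i f)) ->
  Num.sqrt (1 + sqnorm (grad f x)) * mean_curvature f x =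
  - (laplacian f x - hessian_form f x / (1 + \sum_i partial i f x ^+ 2)).
Proof.
move=> Cf; pose P y := 1 + \sum_j partial j f y * partial j f y.
have P0 y : 0 < P y by rewrite ltr_pwDl// sumr_ge0// => j _; rewrite -expr2 sqr_ge0.
have EP y : 1 + sqnorm (grad f y) = P y.
  by rewrite sqnorm_grad; congr (_ + _); apply: eq_bigr => j _; rewrite expr2.
have -> : 1 + \sum_i partial i f x ^+ 2 = P x by rewrite -sqnorm_grad EP.
rewrite EP /mean_curvature mulrN; congr (- _).
have dj i j : is_derive x (delta_mx 0 i) (partial j f) (partial i (partial j f) x).
  by apply: derivableP; have [_ df _] := Cf j; exact: df.
have dP i : is_derive x (delta_mx 0 i) P
    (\sum_j 2 * (partial j f x * partial i (partial j f) x)).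
  have CS j : C1 (fun y => partial j f y * partial j f y) by exact: C1M.
  have [_ dP _] : C1 P by apply: C1D; [exact: C1_cst|exact: C1_sum].
  apply: is_derive_eq (derivableP (dP i x)) _; rewrite -/(partial i P x).
  rewrite partialD; [|exact: C1_cst|exact: C1_sum].
  rewrite partial_cst add0r partial_sum//; apply: eq_bigr => j _.
  by rewrite partialM//; ring.
have dw i : is_derive x (delta_mx 0 i)
    (fun y => ((Num.sqrt (1 + sqnorm (grad f y)))^-1 *: grad f y) 0 i)
    ((Num.sqrt (P x))^-1 * partial i (partial i f) x +
     partial i f x * (- (\sum_j 2 * (partial j f x * partial i (partial j f) x))
       / (2 * P x * Num.sqrt (P x)))).
  rewrite (_ : (fun y => _) = (fun y => (Num.sqrt (P y))^-1) * partial i f); last first.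
    by apply/funext => y; rewrite !mxE EP.
  by apply: is_derive_eq (is_deriveM (is_derive_inv_sqrt (P0 x) (dP i)) (dj i i)) _.
have s0 : Num.sqrt (P x) != 0 by rewrite gt_eqF// sqrtr_gt0.
have p0 : P x != 0 by rewrite gt_eqF.
rewrite /divergence mulr_sumr /laplacian /hessian_form mulr_suml -sumrB.
apply: eq_bigr => i _.
have dwE : partial i (fun y =>
    ((Num.sqrt (1 + sqnorm (grad f y)))^-1 *: grad f y) 0 i) x = _ :=
  @derive_val _ _ _ _ _ _ _ (dw i).
have -> : \sum_j partial i f x * partial j f x * partial i (partial j f) x =
    partial i f x * \sum_j partial j f x * partial i (partial j f) x.
  by rewrite mulr_sumr; apply: eq_bigr => j _; rewrite mulrA.
rewrite dwE -mulr_sumr; field.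
by apply/andP; split.
Qed.

(* Dominates the sum of the squares of [a i j - l * (w i * w j)] for
   [l = D / (1 + |w|^2)]. *)
Lemma hessian_form_ge0 (w : 'I_d -> R) (a : 'I_d -> 'I_d -> R) D :
  0 <= D ^+ 2 - 2 * D * ((\sum_i \sum_j w i * w j * a i j) / (1 + \sum_i w i ^+ 2))
    + \sum_i \sum_j a i j ^+ 2.
Proof.
set Q := \sum_i \sum_j _; set N := \sum_i w i ^+ 2; set S := \sum_i \sum_j a i j ^+ 2.
have N0 : 0 <= N by rewrite sumr_ge0// => i _; rewrite sqr_ge0.
pose l := D / (1 + N).
have : 0 <= \sum_i \sum_j (a i j - l * (w i * w j)) ^+ 2.
  by apply: sumr_ge0 => i _; apply: sumr_ge0 => j _; rewrite sqr_ge0.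
have -> : \sum_i \sum_j (a i j - l * (w i * w j)) ^+ 2 = S - 2 * l * Q + l ^+ 2 * N ^+ 2.
  have -> : N ^+ 2 = \sum_i \sum_j (w i ^+ 2 * w j ^+ 2).
    by rewrite expr2 mulr_suml; apply: eq_bigr => i _; rewrite mulr_sumr.
  rewrite /S /Q !mulr_sumr -sumrB -big_split/=; apply: eq_bigr => i _.
  rewrite !mulr_sumr -sumrB -big_split/=; apply: eq_bigr => j _; ring.
have N1 : 1 + N != 0 by rewrite gt_eqF// ltr_wpDr.
have -> : D ^+ 2 - 2 * D * (Q / (1 + N)) + S = S - 2 * l * Q + D ^+ 2.
  by rewrite /l; field.
(* What remains is [l ^+ 2 * N ^+ 2 <= D ^+ 2], which holds because [0 <= N <= 1 + N]. *)
move/le_trans; apply; rewrite lerD2l /l expr_div_n mulrAC.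
rewrite ler_pdivrMr ?exprn_gt0 ?ltr_wpDr//.
by rewrite ler_wpM2l ?sqr_ge0// ler_sqr ?nnegrE//; lra.
Qed.

End mean_curvature.

(** * Pointwise dissipation of the Dirichlet energy *)

Section dirichlet_energy.
Variables (R : realType) (d : nat).
Implicit Types (f g : 'rV[R]_d -> R).

Lemma lattice_periodic_partial (B : 'M[R]_d) f i :
  lattice_periodic B f -> lattice_periodic B (partial i f).
Proof.
move=> pf k x; rewrite /partial /derive (_ : (fun h : R => _) =
  (fun h : R => h^-1 *: ((f \o shift x) (h *: delta_mx 0 i) - f x)))//.
by apply/funext => h /=; rewrite addrA !pf.
Qed.

Lemma lattice_periodic_op (B : 'M[R]_d) (op : R -> R -> R) f g :
  lattice_periodic B f -> lattice_periodic B g ->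
  lattice_periodic B (fun x => op (f x) (g x)).
Proof. by move=> pf pg k x; rewrite pf pg. Qed.

Lemma lattice_periodic_sum (B : 'M[R]_d) n (f : 'I_n -> 'rV[R]_d -> R) :
  (forall i, lattice_periodic B (f i)) -> lattice_periodic B (fun x => \sum_i f i x).
Proof. by move=> pf k x; apply: eq_bigr => i _; rewrite pf. Qed.

(* The field whose divergence is [2 <grad f, grad g> + 2 g (laplacian f)
   - (laplacian f)^2 + |D^2 f|^2], the two third-order terms cancelling. *)
Definition energy_field f g i x :=
  2 * (partial i f x * g x) + -1 * (partial i f x * laplacian f x)
  + \sum_j partial j f x * partial j (partial i f) x.

Lemma lattice_periodic_energy_field (B : 'M[R]_d) f g i : lattice_periodic B f ->
  lattice_periodic B g -> lattice_periodic B (energy_field f g i).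
Proof.
move=> pf pg; have p1 j := lattice_periodic_partial j pf.
have p2 j k := lattice_periodic_partial j (p1 k).
apply: lattice_periodic_op.
  apply: (lattice_periodic_op (fun a b => 2 * a + -1 * b)).
    exact: lattice_periodic_op.
  by apply: lattice_periodic_op => //; exact: lattice_periodic_sum.
by apply: lattice_periodic_sum => j; exact: lattice_periodic_op.
Qed.

Lemma C1_laplacian f : (forall i j, C1 (partial i (partial j f))) -> C1 (laplacian f).
Proof. by move=> C3; apply: C1_sum => i. Qed.

Lemma C1_energy_field f g i : (forall i, C1 (partial i f)) ->
  (forall i j, C1 (partial i (partial j f))) -> C1 g -> C1 (energy_field f g i).
Proof.
move=> C2 C3 Cg; apply: C1D; last by apply: C1_sum => j; exact: C1M.
apply: C1D; (apply: C1M; first exact: C1_cst); apply: C1M => //.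
exact: C1_laplacian.
Qed.

(** Two third-order sums appear, one from differentiating the Laplacian and one, of opposite sign,
    from the last sum of the field. Exchanging the summation indices and commuting derivatives of
    [partial j f] identifies them. *)
Lemma divergence_energy_field f g x : C1 f -> (forall i, C1 (partial i f)) ->
  (forall i j, C1 (partial i (partial j f))) -> C1 g ->
  \sum_i partial i (energy_field f g i) x =
    2 * (\sum_i partial i f x * partial i g x) + 2 * g x * laplacian f x
    - laplacian f x ^+ 2 + \sum_i \sum_j partial i (partial j f) x ^+ 2.
Proof.
move=> C1f C2 C3 Cg.
have CL := C1_laplacian C3.
have E i : partial i (energy_field f g i) x =
    2 * (partial i f x * partial i g x) + 2 * g x * partial i (partial i f) x
    - \sum_j partial i f x * partial i (partial j (partial j f)) x
    - laplacian f x * partial i (partial i f) x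
    + (\sum_j partial j f x * partial i (partial j (partial i f)) x
      + \sum_j partial i (partial j f) x ^+ 2).
  have Ca := C1M (C2 i) Cg; have Cb := C1M (C2 i) CL.
  have Cc j := C1M (C2 j) (C3 j i).
  have E1 := @partialM R d _ _ i x (C1_cst d 2) Ca.
  have E2 := @partialM R d _ _ i x (C1_cst d (-1)) Cb.
  have E3 : partial i (fun y => \sum_j partial j f y * partial j (partial i f) y) x =
      \sum_j partial j f x * partial i (partial j (partial i f)) x
      + \sum_j partial i (partial j f) x ^+ 2.
    rewrite (partial_sum _ _ Cc) -big_split/=; apply: eq_bigr => j _.
    apply: etrans (@partialM R d _ _ i x (C2 j) (C3 j i)) _; rewrite expr2.
    (* Symmetry turns the product of the two mixed second derivatives into a square. *)
    exact: (congr1 (fun z => _ + z * _) (partialC x C1f (C2 i) (C2 j))).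
  have E4 : partial i (laplacian f) x = \sum_j partial i (partial j (partial j f)) x.
    exact: (partial_sum _ _ (fun j => C3 j j)).
  rewrite /energy_field (@partialD R d _ _ i x (C1D (C1M (C1_cst d 2) Ca)
    (C1M (C1_cst d (-1)) Cb)) (C1_sum Cc)) E3; congr (_ + _).
  rewrite (@partialD R d _ _ i x (C1M (C1_cst d 2) Ca) (C1M (C1_cst d (-1)) Cb)).
  have E5 := @partialM R d _ _ i x (C2 i) Cg.
  have E6 := @partialM R d _ _ i x (C2 i) CL.
  rewrite partial_cst E5 in E1; rewrite partial_cst E6 E4 in E2.
  by rewrite E1 E2 -mulr_sumr; ring.
(* The bookkeeping is done on abstract families. [X] and [Y] stand for the third-order terms: they
   are only required to agree after summation over [i], not termwise. *)
have alg (p q L X Y S : 'I_d -> R) a b : b = \sum_i L i -> \sum_i X i = \sum_i Y i ->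
    \sum_i (2 * (p i * q i) + 2 * a * L i - X i - b * L i + (Y i + S i)) =
    2 * (\sum_i p i * q i) + 2 * a * b - b ^+ 2 + \sum_i S i.
  by move=> bE XY; rewrite !big_split/= !sumrN -!mulr_sumr -bE XY; ring.
apply: etrans (eq_bigr _ (fun i _ => E i)) _.
apply: (alg (fun i => partial i f x) (fun i => partial i g x)
  (fun i => partial i (partial i f) x)
  (fun i => \sum_j partial i f x * partial i (partial j (partial j f)) x)
  (fun i => \sum_j partial j f x * partial i (partial j (partial i f)) x)
  (fun i => \sum_j partial i (partial j f) x ^+ 2)).
  by [].
rewrite [RHS]exchange_big/=; apply: eq_bigr => i _; apply: eq_bigr => j _.
exact: (congr1 (fun z => _ * z) (esym (partialC x (C2 j) (C3 i j) (C3 j j)))).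
Qed.

(** The equation expresses [g] through spatial derivatives of [f], which inherit the periodicity of
    [f]. With [g] the time derivative, this makes the energy field periodic. *)
Lemma lattice_periodic_mcf (B : 'M[R]_d) f g : (forall i, C1 (partial i f)) ->
  (forall x, g x + Num.sqrt (1 + sqnorm (grad f x)) * mean_curvature f x = 0) ->
  lattice_periodic B f -> lattice_periodic B g.
Proof.
move=> C2 gE pf; have p1 j := lattice_periodic_partial j pf.
have p2 j k := lattice_periodic_partial j (p1 k).
have -> : g = fun x => laplacian f x -
    hessian_form f x / (1 + \sum_i partial i f x ^+ 2).
  by apply/funext => x; have /eqP := gE x; rewrite mean_curvatureE// subr_eq0 => /eqP.
apply: (lattice_periodic_op (fun a b => a - b)); first exact: lattice_periodic_sum.
apply: (lattice_periodic_op (fun a b => a / (1 + b))); last first.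
  by apply: lattice_periodic_sum => j k x; rewrite p1.
apply: lattice_periodic_sum => i; apply: lattice_periodic_sum => j.
by apply: lattice_periodic_op => //; exact: lattice_periodic_op.
Qed.

(** Substituting [g = D - Q] from the equation, with [D] the Laplacian and [Q] the quotient of the
    Hessian form, the remaining terms [2 g D - D^2 + S] of the divergence become [D^2 - 2 D Q + S],
    which [hessian_form_ge0] bounds below by zero. *)
Lemma energy_dissipation f g x : C1 f -> (forall i, C1 (partial i f)) ->
  (forall i j, C1 (partial i (partial j f))) -> C1 g ->
  g x + Num.sqrt (1 + sqnorm (grad f x)) * mean_curvature f x = 0 ->
  2 * (\sum_i partial i f x * partial i g x) <=
  \sum_i partial i (energy_field f g i) x.
Proof.
move=> C1f C2 C3 Cg /eqP; rewrite mean_curvatureE// subr_eq0 => /eqP gE.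
rewrite divergence_energy_field// -subr_ge0 gE.
have := hessian_form_ge0 (fun i => partial i f x)
  (fun i j => partial i (partial j f) x) (laplacian f x).
rewrite -/(hessian_form f x); set Q := hessian_form f x / _; set S := \sum_i \sum_j _.
set D := laplacian f x; set G := \sum_i _; move=> H.
by rewrite (_ : _ - _ = D ^+ 2 - 2 * D * Q + S)//; ring.
Qed.

End dirichlet_energy.

(** * Monotonicity of the energy along the flow *)

Theorem propositionB1 (R : realType) (d : nat) (hd : (1 <= d)%N)
  (B : 'M[R]_d) (hB : B \in unitmx)
  (T : R) (hT : 0 < T)
  (h : R -> 'rV[R]_d -> R)
  (h_periodic : forall t : R, t \in `[0, T] -> lattice_periodic B (h t))
  (h_smooth : smooth T h)
  (h_mcf : forall (t : R) (x : 'rV[R]_d), t \in `[0, T] ->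
     dtime T h t x
     + Num.sqrt (1 + sqnorm (grad (h t) x)) * mean_curvature (h t) x = 0) :
  forall t : R, t \in `[0, T] ->
    let E := fun s : R => torus_integral B (fun x => sqnorm (grad (h s) x)) in
    derivable_in `[0, T] E t /\ derive_in `[0, T] E t <= 0.
Proof.
move=> t tT E.
(* The integrand of [E] with its squares written as products, so that the product rule yields its
   time derivative [g']. *)
pose g s x := \sum_i partial i (h s) x * partial i (h s) x.
pose ht i := dtime T (fun s => partial i (h s)).
pose g' s x := \sum_i (ht i s x * partial i (h s) x + partial i (h s) x * ht i s x).
have EE : E = (fun s => torus_integral B (g s)).
  apply/funext => s; congr (torus_integral B _); apply/funext => x.
  by rewrite sqnorm_grad; apply: eq_bigr => i _; rewrite expr2.
have smi i := smooth_partial i h_smooth.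
have smt i : smooth T (ht i) := smooth_dtime (smi i).
have sC1 (u : R -> 'rV[R]_d -> R) : smooth T u -> C1 (u t).
  by move=> su; exact: smooth_C1 su tT.
have cg s : s \in `[0, T] -> continuous (g s).
  move=> sT; have [] // : C1 (g s).
  by apply: C1_sum => i; apply: C1M; exact: (smooth_C1 (smi i)).
have jg' : jointly_continuous `[0, T] g'.
  apply: within_jointly_continuous; apply/subspace_continuousP => p pT.
  apply: (cvg_sumr (f := fun i (p : R * 'rV[R]_d) => ht i p.1 p.2 * partial i (h p.1) p.2
    + partial i (h p.1) p.2 * ht i p.1 p.2)) => i.
  have /subspace_continuousP/(_ p pT) c1 := smooth_within_continuous (smi i).
  have /subspace_continuousP/(_ p pT) c2 := smooth_within_continuous (smt i).
  exact: (cvgD (cvgM c2 c1) (cvgM c1 c2)).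
have dg s x : s \in `[0, T] -> has_derive_in `[0, T] (g^~ x) s (g' s x).
  move=> sT; apply: has_derive_in_sum => i.
  by apply: has_derive_inM; exact: smooth_has_derive_in (smi i) sT.
have dE := torus_integral_has_derive_in (B := B) tT cg dg jg'.
rewrite -EE in dE.
(* [E] has derivative the integral of [g' t]; only the sign of that integral is left. *)
have [dE1 ->] := has_derive_in_derivable hT tT dE; split => //.
have C1f := sC1 _ h_smooth.
have C2 i : C1 (partial i (h t)) := sC1 _ (smi i).
have C3 i j : C1 (partial i (partial j (h t))) := sC1 _ (smooth_partial i (smi j)).
have Cg := sC1 _ (smooth_dtime h_smooth).
pose F := energy_field (h t) (dtime T h t).
have CF i : C1 (F i) by exact: C1_energy_field.
have cdF i : continuous (partial i (F i)) by have [] := CF i.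
have pF i : lattice_periodic B (F i).
  have pf := h_periodic t tT; apply: lattice_periodic_energy_field => //.
  by apply: (lattice_periodic_mcf C2 _ pf) => x; exact: h_mcf.
(* [g' t] lies pointwise below the divergence of the periodic field [F], and that divergence
   integrates to zero. *)
apply: (@le_trans _ _ (torus_integral B (fun x => \sum_i partial i (F i) x))).
  apply: le_torus_integral => [||u _].
  - exact: jointly_continuous_slice jg' tT.
  - exact: continuous_sumr.
  - set x := cell_point B u.
    apply: le_trans (energy_dissipation C1f C2 C3 Cg (h_mcf t x tT)).
    rewrite /g' mulr_sumr; apply: ler_sum => i _.
    (* Exchanging time and space derivatives makes [ht i t x] the [i]-th partial derivative of
       [dtime T h t]. *)
    by rewrite /ht dtime_partial//; lra.
rewrite torus_integral_sum// big1// => i _.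
exact: torus_integral_partial.
Qed.
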